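(* Let $G=(V,E)$ be a finite graph with $V\neq\varnothing$ and maximum degree $\Delta$, let $\beta,\gamma>0$, and let $X$ be a random independent set of $G$ such that $$\frac{1}{|V|}\sum_{u\in V}\big(\beta\Pr(u\in X)+\gamma\,\mathbb{E}|X\cap N(u)|\big)\ge 1.$$ Then $$\frac{\mathbb{E}|X|}{|V|}\ge\frac{1}{\beta+\gamma\Delta}.$$
   Context: $N(u)$ denotes the set of neighbours of $u$ in $G$. A random independent set of $G$ is a random variable, with an arbitrary distribution, taking values in the collection of independent sets of $G$ (including $\varnothing$). *)

(* Defs.v *)
From HB Require Import structures.
From mathcomp Require Import all_boot all_order all_algebra.
From mathcomp Require Import all_classical all_reals all_analysis.

Set Implicit Arguments.
Unset Strict Implicit.
Unset Printing Implicit Defensive.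

Record sgraph := SGraph {
  vertex :> finType;
  adj : rel vertex;
  adj_sym : symmetric adj;
  adj_irrefl : irreflexive adj
}.

Definition nbrs (G : sgraph) (u : G) : {set G} := [set v | adj u v]%SET.

Definition max_degree (G : sgraph) : nat := \max_(u : G) #|nbrs u|.

Definition independent (G : sgraph) (S : {set G}) : bool :=
  [forall u in S, forall v in S, ~~ adj u v].

Record indset (G : sgraph) := IndSet {
  indset_val :> {set G};
  indset_valP : independent indset_val
}.

HB.instance Definition _ (G : sgraph) := [isSub for @indset_val G].
HB.instance Definition _ (G : sgraph) := [Finite of indset G by <:].

Lemma independent0 (G : sgraph) : @independent G finset.set0.
Proof. by apply/forall_inP => u; rewrite inE. Qed.

HB.instance Definition _ (G : sgraph) :=
  isPointed.Build (indset G) (IndSet (independent0 G)).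

(* With every subset measurable, a random variable with values in [indset G]
   is a map all of whose fibres are events. *)
HB.instance Definition _ (G : sgraph) :=
  @isMeasurable.Build default_measure_display (indset G)
    discrete_measurable discrete_measurable0
    discrete_measurableC discrete_measurableU.

(* Main.v *)
Require Import Defs.
From mathcomp Require Import all_boot all_order all_algebra.
From mathcomp Require Import all_classical all_reals all_analysis.
Import Order.TTheory GRing.Theory Num.Theory.
Local Open Scope classical_set_scope.
Local Open Scope ring_scope.

(* By linearity of expectation only the marginals p v := P(v \in X) matter.
   Summed over u, E|X :&: nbrs u| counts each p v exactly #|nbrs v| times,
   hence at most max_degree G times. *)

(** Put s = E|X|, the sum of all [p v]. By [expectation_card_setI] the hypothesis is a linear
    inequality in the marginals, and [sum_nbrs_le] bounds its neighbour term by
    [gamma * max_degree G * s]. Hence #|G| <= (beta + gamma * max_degree G) * s, and dividing gives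
    the claim. *)

Lemma measurable_mem_indset {R : realType} {G : sgraph} {d : measure_display}
    {Omega : measurableType d} {P : probability Omega R}
    (X : {RV P >-> indset G}) (v : G) :
  measurable [set w | v \in (X w : {set G})].
Proof.
rewrite -[X in measurable X]setTI.
exact: (measurable_funPT X measurableT [set S | v \in (S : {set G})]).
Qed.

(** The cardinality is a sum of indicators of the events [v \in X w], integrated term by term. It
    serves both for neighbourhoods and for the whole vertex set. *)
Lemma expectation_card_setI {R : realType} {G : sgraph} {d : measure_display}
    {Omega : measurableType d} {P : probability Omega R}
    (X : {RV P >-> indset G}) (A : {set G}) :
  ('E_P[fun w => #|(X w : {set G}) :&: A|%:R] =
    \sum_(v in A) P [set w | v \in (X w : {set G})])%E.
Proof.
have mX := measurable_mem_indset X.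
rewrite -big_enum unlock -[RHS](@eq_bigr _ _ _ _ _ _
  (fun v => \int[P]_w (\1_[set w | v \in (X w : {set G})] w)%:E)%E); last first.
  by move=> v _; rewrite integral_indic// setIT.
rewrite -ge0_integral_sum//; last first.
  by move=> v; apply/measurable_realfun.measurable_EFinP; exact: measurable_realfun.measurable_indic.
apply: eq_integral => w _; rewrite sumEFin big_enum /=; congr EFin.
(* Both sums are extended to all vertices, to be compared termwise. *)
rewrite -sum1_card natr_sum [LHS]big_mkcond [RHS]big_mkcond.
apply: eq_bigr => v _; rewrite inE indicE [w \in _]asboolb.
by case: (v \in A); rewrite ?andbT ?andbF//; case: (v \in _).
Qed.

(** Double counting: after exchanging the sums, [f v] is weighted by the number of [u] having [v] as
    a neighbour, which is the degree of [v] by symmetry. *)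
Lemma sum_nbrs_le {R : realType} {G : sgraph} (f : G -> R) :
  (forall v, 0 <= f v) ->
  \sum_u \sum_(v in nbrs u) f v <= (max_degree G)%:R * \sum_v f v.
Proof.
move=> f0; rewrite (exchange_big_dep predT)//= mulr_sumr; apply: ler_sum => v _.
rewrite sumr_const -[_ *+ _]mulr_natl ler_wpM2r// ler_nat.
apply: leq_trans (leq_bigmax v); apply: eq_leq; apply: eq_card => u.
by change (v \in nbrs u = (u \in nbrs v)); rewrite !inE adj_sym.
Qed.

Theorem theorem3p3 (R : realType) (G : sgraph) (V_nonempty : (0 < #|G|)%N)
    (beta gamma : R) (beta_gt0 : 0 < beta) (gamma_gt0 : 0 < gamma)
    (d : measure_display) (Omega : measurableType d) (P : probability Omega R)
    (X : {RV P >-> indset G})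
    (hX : (1 <= (#|G|%:R^-1)%:E *
             \sum_(u : G) (beta%:E * P [set w | u \in (X w : {set G})] +
               gamma%:E * 'E_P[fun w => #|(X w : {set G}) :&: nbrs u|%:R]))%E) :
  ((beta + gamma * (max_degree G)%:R)^-1%:E <=
     'E_P[fun w => #|(X w : {set G})|%:R] * (#|G|%:R^-1)%:E)%E.
Proof.
(* Probabilities are finite, so the whole inequality can be moved from extended reals to [R]. *)
pose p v := fine (P [set w | v \in (X w : {set G})]).
have pE v : P [set w | v \in (X w : {set G})] = (p v)%:E.
  by rewrite fineK// fin_num_measure//; exact: measurable_mem_indset.
have p_ge0 v : 0 <= p v by rewrite fine_ge0.
have EE (A : {set G}) :
    ('E_P[fun w => #|(X w : {set G}) :&: A|%:R] = (\sum_(v in A) p v)%:E)%E.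
  by rewrite expectation_card_setI -sumEFin; apply: eq_bigr => v _; rewrite pE.
have -> : ('E_P[fun w => #|(X w : {set G})|%:R] = (\sum_v p v)%:E)%E.
  have := EE [set: G]%SET.
  under [in X in X -> _]eq_fun do rewrite finset.setIT.
  by under eq_bigl do rewrite inE.
move: hX; under eq_bigr do rewrite pE EE -!EFinM -EFinD.
rewrite sumEFin -!EFinM !lee_fin big_split/= -!mulr_sumr => hX.
have D_gt0 : 0 < beta + gamma * (max_degree G)%:R.
  by rewrite ltr_wpDr// mulr_ge0// ltW.
have n_gt0 : 0 < #|G|%:R :> R by rewrite ltr0n.
rewrite -[X in X <= _]mul1r ler_pdivrMr// (le_trans hX)//.
(* Cancelling 1/#|G|, the [beta] terms and then [gamma] leaves exactly the double count. *)
rewrite mulrC mulrAC ler_pM2r ?invr_gt0// mulrDr mulrC lerD2l.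
rewrite mulrCA ler_pM2l// [leRHS]mulrC; exact: sum_nbrs_le.
Qed.
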